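(* Let $n\ge2$. A matrix $M\in\mathbb{C}^{n\times n}$ is proper if and only if every principal minor of $M$ is nonzero.
   Context: For $M\in\mathbb{C}^{n\times n}$, let $f_M=(f_{M,1},\dots,f_{M,n}):\mathbb{C}^n\to\mathbb{C}^n$ with $f_{M,k}(x)=x_k(Mx)_k-1$. $M$ is called proper if $|f_M(x)|\to\infty$ as $|x|\to\infty$; equivalently, $f_M^{-1}(C)$ is compact for every compact $C\subset\mathbb{C}^n$. A principal minor of $M$ is the determinant of a submatrix $(m_{kj})_{k,j\in S}$ for a nonempty $S\subseteq\{1,\dots,n\}$. *)

(* Defs.v *)
From mathcomp Require Import all_boot all_order all_algebra.
From mathcomp Require Import complex reals.

Set Implicit Arguments.
Unset Strict Implicit.
Unset Printing Implicit Defensive.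

Import Order.TTheory GRing.Theory Num.Theory.
Local Open Scope ring_scope.
Local Open Scope complex_scope.

(* The norm inherited from [numDomainType] on [R[i]] takes its values in
   [R[i]]; [Normc.normc] is the same modulus with values in [R]. *)
Definition enorm (R : realType) (n : nat) (x : 'cV[R[i]]_n) : R :=
  Num.sqrt (\sum_(k < n) Normc.normc (x k 0) ^+ 2).

Definition fmap (R : realType) (n : nat) (M : 'M[R[i]]_n) (x : 'cV[R[i]]_n) :
    'cV[R[i]]_n :=
  \col_(k < n) (x k 0 * (M *m x) k 0 - 1).

Definition proper_mx (R : realType) (n : nat) (M : 'M[R[i]]_n) : Prop :=
  forall A : R, exists B : R, forall x : 'cV[R[i]]_n,
    B < enorm x -> A < enorm (fmap M x).

(* [enum_val] lists [S] in increasing order, so this is the determinant of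
   (m_kj) for k, j in S. *)
Definition principal_minor (R : realType) (n : nat) (M : 'M[R[i]]_n)
    (S : {set 'I_n}) : R[i] :=
  \det (\matrix_(k < #|S|, j < #|S|) M (enum_val k) (enum_val j)).

(* Main.v *)
Require Import Defs.
From mathcomp Require Import all_boot all_order all_algebra.
From mathcomp Require Import complex reals.

(** Write [y = M x], so that the components of [fmap M x] are [x_k y_k - 1].

    If a principal submatrix [M_S] is singular, a nonzero kernel vector of
    [M_S], extended by zero outside [S], satisfies [x_k y_k = 0] for every [k]:
    outside [S] because [x_k = 0], on [S] because [y_k = 0].  This persists on
    the whole line spanned by [x], which is unbounded, while [fmap M] is
    constantly [-1] there; [singular_minor_null_vector]
    provides such an [x].

    Conversely, assume that all products [x_k y_k] are bounded by [C] and let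
    [S] be the set of the [k] with [`|x_k| > 1].  On [S] the product bound
    forces [`|y_k| <= C], and outside [S] the entries of [x] are at most [1].
    Hence [M_S x_S], which is [y_S] minus the contribution of the small
    entries, is bounded, and so is [x_S] since [M_S] is invertible
    ([minor_unit_bound]).  There are finitely many [S], so the bound is uniform
    in [x] ([products_bound]).  This explicit estimate replaces the
    compactness of the unit sphere. *)

Local Open Scope ring_scope.
Local Open Scope complex_scope.

Import Order.TTheory GRing.Theory Num.Theory.

(** Being above a norm makes [a] real, although the order on [K] is partial. *)
Lemma norm_le_norm (K : numDomainType) (z a : K) :
  `|z| <= a -> `|z| <= `|a|.
Proof.
by move=> za; rewrite (le_trans za) // real_ler_norm // ger0_real //
  (le_trans _ za).
Qed.

Section PrincipalSubmatrix.

Variables (K : numFieldType) (n : nat).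
Implicit Types (M : 'M[K]_n) (S : {set 'I_n}).

Definition principal_submx M S : 'M[K]_#|S| :=
  \matrix_(k, j) M (enum_val k) (enum_val j).

Lemma mulmx_principal_split M S (x : 'cV[K]_n) (k : 'I_#|S|) :
  (M *m x) (enum_val k) 0 =
    (principal_submx M S *m \col_j x (enum_val j) 0) k 0
    + \sum_(l | l \notin S) M (enum_val k) l * x l 0.
Proof.
rewrite !mxE (bigID (mem S)) /= big_enum_val; congr (_ + _).
by apply: eq_bigr => j _; rewrite !mxE.
Qed.

(** The null vector is the zero extension of a kernel vector of the singular
    submatrix, so one of the two factors always vanishes. *)
Lemma singular_minor_null_vector M S :
    \det (principal_submx M S) = 0 ->
  exists2 x : 'cV[K]_n, x != 0 & forall k, x k 0 * (M *m x) k 0 = 0.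
Proof.
rewrite -det_tr => /eqP/det0P[v v0 /(congr1 trmx)].
rewrite trmx_mul trmxK trmx0 => kerv.
pose x : 'cV[K]_n := \col_k \sum_(j < #|S| | enum_val j == k) v 0 j.
have xS j : x (enum_val j) 0 = v 0 j.
  by rewrite mxE (big_pred1 j) // => i; rewrite (inj_eq enum_val_inj).
have xNS k : k \notin S -> x k 0 = 0.
  move=> kS; rewrite mxE big_pred0 // => j.
  by apply: contraNF kS => /eqP <-; apply: enum_valP.
exists x => [|k].
  apply: contraNneq v0 => x0; apply/eqP/rowP => j.
  by rewrite -xS x0 !mxE.
have [kS|/xNS->] := boolP (k \in S); last by rewrite mul0r.
rewrite -(enum_rankK_in kS kS) mulmx_principal_split.
have -> : \col_j x (enum_val j) 0 = v^T :> 'cV_#|S|.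
  by apply/colP => j; rewrite mxE xS mxE.
rewrite kerv [X in X + _]mxE add0r big1 ?mulr0 // => l /xNS->.
by rewrite mulr0.
Qed.

(** Multiplying by the inverse of the principal submatrix bounds the entries
    of [x] on [S] explicitly, because [M_S x_S] only involves entries of [M x]
    on [S] and entries of [x] outside [S], which are both controlled. *)
Lemma minor_unit_bound M S (C : K) :
    \det (principal_submx M S) != 0 ->
  exists2 B : K, 0 <= B & forall x : 'cV[K]_n,
    (forall k, k \in S -> `|(M *m x) k 0| <= C) ->
    (forall k, k \notin S -> `|x k 0| <= 1) ->
    forall k, k \in S -> `|x k 0| <= B.
Proof.
move=> detS; set N := principal_submx M S.
have Nu : N \in unitmx by rewrite unitmxE unitfE.
(* bounds the j-th entry of [M_S x_S] *)
pose D (j : 'I_#|S|) := `|C| + \sum_(l | l \notin S) `|M (enum_val j) l|.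
have D0 j : 0 <= D j by rewrite addr_ge0 ?sumr_ge0.
have D'0 i : 0 <= \sum_j `|invmx N i j| * D j.
  by rewrite sumr_ge0 // => j _; rewrite mulr_ge0.
exists (\sum_i \sum_j `|invmx N i j| * D j); first by rewrite sumr_ge0.
move=> x yC x1 k kS; rewrite -(enum_rankK_in kS kS).
set i := enum_rank_in kS k; pose xS : 'cV_#|S| := \col_j x (enum_val j) 0.
have -> : x (enum_val i) 0 = (invmx N *m (N *m xS)) i 0.
  by rewrite mulKmx // mxE.
have NxS j : `|(N *m xS) j 0| <= D j.
  have -> : (N *m xS) j 0 = (M *m x) (enum_val j) 0
      - \sum_(l | l \notin S) M (enum_val j) l * x l 0.
    by rewrite mulmx_principal_split addrK.
  apply: le_trans (ler_normB _ _) _; apply: lerD.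
    by apply/norm_le_norm/yC/enum_valP.
  apply: le_trans (ler_norm_sum _ _ _) _; apply: ler_sum => l lS.
  by rewrite normrM ler_piMr // x1.
rewrite (bigD1 i) //= -[leLHS]addr0 lerD ?sumr_ge0 //.
rewrite mxE (le_trans (ler_norm_sum _ _ _)) //; apply: ler_sum => j _.
by rewrite normrM ler_wpM2l.
Qed.

(** The set of large entries depends on [x], hence the sum over all [S] of the
    bounds attached to each of them.  The summand [1] covers the entries
    outside that set. *)
Lemma products_bound M (C : K) :
    (forall S, S != set0 -> \det (principal_submx M S) != 0) ->
  exists B : K, forall x : 'cV[K]_n, (forall k, `|x k 0 * (M *m x) k 0| <= C) ->
    forall k, `|x k 0| <= B.
Proof.
move=> minors.
have /fin_all_exists2[B B0 bnd] S : exists2 B : K, 0 <= B & forall x : 'cV[K]_n,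
    (forall k, k \in S -> `|(M *m x) k 0| <= C) ->
    (forall k, k \notin S -> `|x k 0| <= 1) ->
    forall k, k \in S -> `|x k 0| <= B.
  have [->|/minors/minor_unit_bound//] := eqVneq S set0.
  by exists 0 => // x _ _ k; rewrite inE.
exists (1 + \sum_S B S) => x xyC k.
pose S := [set k | ~~ (`|x k 0| <= 1)].
have small j : j \notin S -> `|x j 0| <= 1 by rewrite inE negbK.
have imgC j : j \in S -> `|(M *m x) j 0| <= C.
  rewrite inE -real_ltNge ?normr_real ?real1 // => /ltW xj.
  by apply: le_trans (xyC j); rewrite normrM ler_peMl.
have [kS|/small xk] := boolP (k \in S); last first.
  by rewrite (le_trans xk) // lerDl sumr_ge0.
apply: le_trans (bnd S x imgC small k kS) _.
by rewrite (bigD1 S) //= addrCA lerDl addr_ge0 ?sumr_ge0.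
Qed.

End PrincipalSubmatrix.

Section EuclideanNorm.

Variables (R : realType) (n : nat).
Implicit Types x : 'cV[R[i]]_n.

Lemma normr_normc (z : R[i]) : `|z| = (Normc.normc z)%:C.
Proof. by case: z. Qed.

Lemma normc_ge0 (z : R[i]) : 0 <= Normc.normc z.
Proof. by case: z => a b; apply: sqrtr_ge0. Qed.

Lemma normc_le_enorm x k : Normc.normc (x k 0) <= enorm x.
Proof.
rewrite -[leLHS]ger0_norm ?normc_ge0 // -sqrtr_sqr ler_wsqrtr //.
by rewrite (bigD1 k) //= lerDl sumr_ge0 // => j _; rewrite sqr_ge0.
Qed.

Lemma enorm_bound x (B : R) :
  (forall k, Normc.normc (x k 0) <= B) ->
  enorm x <= Num.sqrt (\sum_(k < n) B ^+ 2).
Proof.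
move=> xB; apply: ler_wsqrtr; apply: ler_sum => k _.
by rewrite lerXn2r ?nnegrE ?normc_ge0 // (le_trans (normc_ge0 (x k 0))).
Qed.

End EuclideanNorm.

Theorem proposition2 (R : realType) (n : nat) (hn : (2 <= n)%N)
    (M : 'M[R[i]]_n) :
  proper_mx M <->
  (forall S : {set 'I_n}, S != set0 -> principal_minor M S != 0).
Proof.
split=> [properM S _|minors A].
  apply/eqP => /singular_minor_null_vector[x x0 gx0].
  have [k xk] : exists k, x k 0 != 0 by apply/cV0Pn.
  have [B /= largeB] := properM (enorm (fmap M 0)).
  (* makes the k-th entry of [t *: x] equal to [`|B| + 1] *)
  pose t := (`|B| + 1)%:C / x k 0.
  have : B < enorm (t *: x).
    apply: lt_le_trans (normc_le_enorm _ _ _ k).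
    rewrite mxE divfK // /Normc.normc /= expr0n addr0 sqrtr_sqr.
    by rewrite ger0_norm ?addr_ge0 // ltr_pwDr // ler_norm.
  move=> /largeB; suff -> : fmap M (t *: x) = fmap M 0 by rewrite ltxx.
  apply/colP => j; rewrite mxE [RHS]mxE -scalemxAr; congr (_ - 1).
  have scaleE (v : 'cV[R[i]]_n) : (t *: v) j 0 = t * v j 0 by rewrite mxE.
  by rewrite !scaleE mulrACA gx0 mulr0 mulmx0 mxE mul0r.
(* [x_k y_k] is the k-th entry of [fmap M x] plus [1], whence [1 + A] *)
have [B bnd] := products_bound _ _ M (1 + A%:C) minors.
exists (Num.sqrt (\sum_(k < n) (Normc.normc B) ^+ 2)) => x.
rewrite !ltNge; apply: contra => fA; apply: enorm_bound => k.
rewrite -lecR -!normr_normc; apply/norm_le_norm/bnd => j.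
rewrite -[X in `|X|](subrK 1) addrC.
apply: le_trans (ler_normD _ _) _; rewrite normr1 lerD2l normr_normc lecR.
apply: le_trans fA; apply: le_trans (normc_le_enorm _ _ _ j).
by rewrite [fmap _ _ _ _]mxE.
Qed.
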